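(* Let $A$ be a free group with free basis $\{a_1,\dots,a_n\}$ and let $T$ be its Cayley graph with respect to this basis. Let $B$ be a group, $\varphi:A\to\mathrm{Aut}(B)$ a homomorphism, and suppose $G=B\rtimes_\varphi A$ is finitely generated. Let $\rho$ be the action of $G$ on $T$ induced by the projection $G\twoheadrightarrow A$ and the natural action of $A$ on $T$. Let $t\in\{a_1,\dots,a_n\}^{\pm}$. Suppose there does not exist an $m\in\mathbb{Z}$ such that $B$ is finitely generated over $A-\mathrm{expsum}_t^{-1}([m,\infty))$. Then any endpoint $e\in\partial T$ represented by an infinite reduced word eventually consisting of only the letter $t^{-1}$ does not lie in $\Sigma^1(\rho)$.
   Context: **Conventions.** Multiplication in $G=B\rtimes_\varphi A$ is $(b_1,a_1)(b_2,a_2)=(b_1\varphi_{a_1}(b_2),a_1a_2)$, so $asa^{-1}=\varphi_a(s)$ for $a\in A$, $s\in B$. $T$ is a simplicial tree with edges of length 1 and vertex set $A$, and $A$ acts on it by left multiplication. $\{a_1,\dots,a_n\}^{\pm}$ is the set of basis elements and their inverses. $B$ is finitely generated over a subset $A'\subseteq A$ if there is a finite $S\subseteq B$ such that $\{asa^{-1}\mid s\in S,\ a\in A'\}$ generates $B$. $\mathrm{expsum}_{a_i}:A\to\mathbb{Z}$ sends an element, written as a reduced word in $\{a_1,\dots,a_n\}^{\pm}$, to the exponent sum of $a_i$ in that word, and $\mathrm{expsum}_{a_i^{-1}}=-\mathrm{expsum}_{a_i}$. **Rays and horoballs.** Points of $\partial T$ are represented uniquely by geodesic rays $\tau:[0,\infty)\to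 T$ with $\tau(0)=1\in A$; such rays correspond to infinite freely reduced words $c_1c_2c_3\cdots$ in $\{a_1,\dots,a_n\}^{\pm}$ via $\tau(k)=c_1\cdots c_k$, and $\tau(\infty)$ denotes the endpoint represented by $\tau$. For real $s$, $HB_s(\tau)=\bigcup_{l\ge\max\{0,s\}}\overline{\mathrm{Ball}_{l-s}(T,\tau(l))}$ (nested union of closed metric balls of radius $l-s$ centred at $\tau(l)$). **$\Sigma^1(\rho)$.** For an isometric action $\rho$ of $G$ on a proper CAT(0) space $M$ (here $M=T$), choose a non-empty free contractible $G$-CW-complex $Y$ and a continuous $G$-map $h:Y\to M$. For a geodesic ray $\tau$ and $s\in\mathbb{R}$ let $Y_{(\tau,s)}$ be the largest subcomplex of $Y$ contained in $h^{-1}(HB_s(\tau))$. Then $h$ is controlled connected over $\tau(\infty)$ if for every cocompact $G$-subspace $L\subseteq Y$ there is a cocompact $G$-subspace $L'\supseteq L$ such that for all $s\in\mathbb{R}$ there exists $\lambda(s)\ge0$ with: $( * )$ any two points of $Y_{(\tau,s)}\cap L$ can be connected by a path in $Y_{(\tau,s-\lambda(s))}\cap L'$; and $( ** )$ any two points of $Y_{(\tau,s+\lambda(s))}\cap L$ can be connected by a path in $Y_{(\tau,s)}\cap L'$. By a theorem of Bieri and Geoghegan this does not depend on the choice of $Y$ and $h$, and $\Sigma^1(\rho)$ is the set of $e\in\partial M$ over which $\rho$ is controlled connected. *)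

(* Defs.v *)
From HB Require Import structures.
From mathcomp Require Import all_boot all_order all_algebra.
From mathcomp Require Import all_classical all_reals all_analysis.
From mathcomp Require Import generic_quotient ring lra.

Set Implicit Arguments.
Unset Strict Implicit.
Unset Printing Implicit Defensive.

Import Order.TTheory GRing.Theory Num.Theory.
Import numFieldNormedType.Exports.

Local Open Scope classical_set_scope.
Local Open Scope ring_scope.

Definition subgroup_set (G : groupType) (H : set G) : Prop :=
  [/\ H 1%g, (forall x y, H x -> H y -> H (x * y)%g) & forall x, H x -> H x^-1%g].

Definition generated (G : groupType) (X : set G) : set G :=
  smallest (@subgroup_set G) X.

Definition finitely_generated (G : groupType) : Prop :=
  exists2 S : set G, finite_set S & generated S = setT.

Record gaction (G : groupType) (M : Type) := GAction {
  gact :> G -> M -> M;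
  gact1 : forall x, gact 1%g x = x;
  gactM : forall g h x, gact (g * h)%g x = gact g (gact h x) }.

(* A homomorphism [A -> Aut(B)]; it preserves [1] by [aut_id] below. *)
Record aut_action (A B : groupType) := AutAction {
  aut :> A -> B -> B;
  aut_morph : forall a, {morph aut a : x y / (x * y)%g};
  aut_bij : forall a, bijective (aut a);
  aut_comp : forall a a' b, aut (a * a')%g b = aut a (aut a' b) }.

Record sdprod (A B : groupType) (phi : aut_action A B) :=
  SDPair { sdl : B; sdr : A }.

HB.instance Definition _ (A B : groupType) (phi : aut_action A B) :=
  gen_eqMixin (sdprod phi).
HB.instance Definition _ (A B : groupType) (phi : aut_action A B) :=
  gen_choiceMixin (sdprod phi).

Section Semidirect.
Variables (A B : groupType) (phi : aut_action A B).
Local Open Scope group_scope.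

Definition sd_one : sdprod phi := SDPair phi 1 1.
Definition sd_mul (x y : sdprod phi) : sdprod phi :=
  SDPair phi (sdl x * phi (sdr x) (sdl y)) (sdr x * sdr y).
Definition sd_inv (x : sdprod phi) : sdprod phi :=
  SDPair phi (phi (sdr x)^-1 (sdl x)^-1) (sdr x)^-1.

Lemma aut_one a : phi a 1 = 1.
Proof. by apply: (mulgI (phi a 1)); rewrite -aut_morph !mulg1. Qed.

Lemma aut_id b : phi 1 b = b.
Proof. by apply: (bij_inj (aut_bij phi 1)); rewrite -aut_comp mulg1. Qed.

Lemma sd_mulA : associative sd_mul.
Proof.
move=> [b a] [b' a'] [b'' a'']; rewrite /sd_mul /=.
by rewrite aut_morph aut_comp !mulgA.
Qed.

Lemma sd_mul1g : left_id sd_one sd_mul.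
Proof. by move=> [b a]; rewrite /sd_mul /= aut_id !mul1g. Qed.

Lemma sd_mulg1 : right_id sd_one sd_mul.
Proof. by move=> [b a]; rewrite /sd_mul /= aut_one !mulg1. Qed.

Lemma sd_mulVg : left_inverse sd_one sd_inv sd_mul.
Proof. by move=> [b a]; rewrite /sd_mul /= -aut_morph !mulVg aut_one. Qed.

Lemma sd_mulgV : right_inverse sd_one sd_inv sd_mul.
Proof. by move=> [b a]; rewrite /sd_mul /= -aut_comp mulgV aut_id !mulgV. Qed.

HB.instance Definition _ :=
  isGroup.Build (sdprod phi) sd_mulA sd_mul1g sd_mulg1 sd_mulVg sd_mulgV.

Definition fg_over (A' : set A) : Prop :=
  exists2 S : set B, finite_set S
    & generated [set b | exists s a, [/\ S s, A' a & b = phi a s]] = setT.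

End Semidirect.

(* [(i, false)] stands for [a_i] and [(i, true)] for [a_i^-1]. *)
Definition letter (n : nat) : Type := ('I_n * bool)%type.
Definition linv n (l : letter n) : letter n := (l.1, ~~ l.2).

Definition reduced n (w : seq (letter n)) : bool :=
  sorted (fun l l' => l' != linv l) w.

Definition reduced_inf n (c : nat -> letter n) : Prop :=
  forall k, c k.+1 <> linv (c k).

Section FreeGroup.
Variables (n : nat) (A : groupType) (a : 'I_n -> A).
Local Open Scope group_scope.

Definition lval (l : letter n) : A := if l.2 then (a l.1)^-1 else a l.1.

Definition wval (w : seq (letter n)) : A := \prod_(l <- w) lval l.

(* [A] is free on [a]: every element is the value of exactly one reduced
   word. *)
Definition free_basis : Prop :=
  forall g : A, exists! w : seq (letter n), reduced w /\ wval w = g.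

(* The reduced word of [g]; the default [[::]] is irrelevant for a free
   basis. *)
Definition rword (g : A) : seq (letter n) :=
  xget [::] [set w | reduced w /\ wval w = g].

Definition wlen (g : A) : nat := size (rword g).

(* [expsum (i, false)] is the exponent sum of [a_i], and [expsum (i, true)]
   its opposite. *)
Definition expsum (t : letter n) (g : A) : int :=
  (count_mem t (rword g))%:Z - (count_mem (linv t) (rword g))%:Z.

Lemma linvK : involutive (@linv n).
Proof. by move=> [i b]; rewrite /linv /= negbK. Qed.

Lemma lval_linv l : lval (linv l) = (lval l)^-1.
Proof. by case: l => i []; rewrite /lval /= ?invgK. Qed.

Lemma wval_nil : wval [::] = 1.
Proof. by rewrite /wval big_nil. Qed.

Lemma wval_cons l w : wval (l :: w) = lval l * wval w.
Proof. by rewrite /wval big_cons. Qed.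

Lemma wval_cat w w' : wval (w ++ w') = wval w * wval w'.
Proof. by rewrite /wval big_cat. Qed.

Lemma wval_inv w : wval (rev (map (@linv n) w)) = (wval w)^-1.
Proof.
elim: w => [|l w IH]; first by rewrite /= wval_nil invg1.
by rewrite /= rev_cons -cats1 wval_cat IH !wval_cons wval_nil mulg1 lval_linv invgM.
Qed.

Lemma reduce w : exists w', [/\ reduced w', wval w' = wval w & (size w' <= size w)%N].
Proof.
elim: w => [|l w [w' [rw' vw' sw']]]; first by exists [::].
case: w' rw' vw' sw' => [|l' w'] rw' vw' sw'.
  by exists [:: l]; rewrite !wval_cons vw'.
have [E|E] := eqVneq l' (linv l); last first.
  by exists (l :: l' :: w'); split => //=; rewrite ?E // !(wval_cons l) vw'.
exists w'; split.
- by move: rw'; rewrite /reduced /=; exact: path_sorted.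
- by rewrite wval_cons -vw' wval_cons E lval_linv mulgA mulgV mul1g.
- by move: sw' => /=; move=> /ltnW sw'; exact: leqW.
Qed.

Hypothesis fa : free_basis.

Lemma rwordP g : reduced (rword g) /\ wval (rword g) = g.
Proof.
rewrite /rword; case: xgetP => [w _ //|] /=.
by have [w [hw _]] := fa g => /(_ w).
Qed.

Lemma rword_wval w : reduced w -> rword (wval w) = w.
Proof.
move=> rw; have [w0 [_ u]] := fa (wval w).
by rewrite -(u _ (rwordP _)) (u w).
Qed.

Lemma wlen_le w : (wlen (wval w) <= size w)%N.
Proof.
have [w' [rw' <- sw']] := reduce w.
by rewrite /wlen rword_wval.
Qed.

Lemma wlen1 : wlen 1 = 0%N.
Proof. by apply/eqP; rewrite -leqn0 -wval_nil; exact: wlen_le. Qed.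

Lemma wlen_eq0 g : wlen g = 0%N -> g = 1.
Proof. by move=> /size0nil e; have [_ <-] := rwordP g; rewrite e wval_nil. Qed.

Lemma wlenM g h : (wlen (g * h) <= wlen g + wlen h)%N.
Proof.
have [_ {1}<-] := rwordP g; have [_ {1}<-] := rwordP h.
by rewrite -wval_cat (leq_trans (wlen_le _)) // size_cat.
Qed.

Lemma wlenV g : wlen g^-1 = wlen g.
Proof.
suff le h : (wlen h^-1 <= wlen h)%N.
  by apply/eqP; rewrite eqn_leq le -{1}[g]invgK le.
have [_ {1}<-] := rwordP h.
by rewrite -wval_inv (leq_trans (wlen_le _)) // size_rev size_map.
Qed.

Lemma wlen_gen i : wlen (a i) = 1%N.
Proof.
have -> : a i = wval [:: (i, false)] by rewrite wval_cons wval_nil mulg1.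
by rewrite /wlen rword_wval.
Qed.

End FreeGroup.

(* Geometric realisation of the Cayley graph of [A] with respect to [a]:
   [Inner g i x] is the point at distance [x] from [g] in the interior of
   the edge from [g] to [g * a i]. *)
Variant ctree (R : realType) (n : nat) (A : groupType) (a : 'I_n -> A)
    (fa : free_basis a) : Type :=
  | Vertex of A
  | Inner (g : A) (i : 'I_n) (x : R) of 0 < x < 1.
Arguments Vertex {R n A a fa} _.
Arguments Inner {R n A a fa} _ _ _ _.

HB.instance Definition _ (R : realType) n (A : groupType) (a : 'I_n -> A)
  (fa : free_basis a) := gen_eqMixin (ctree R fa).
HB.instance Definition _ (R : realType) n (A : groupType) (a : 'I_n -> A)
  (fa : free_basis a) := gen_choiceMixin (ctree R fa).

Section CayleyTree.
Variables (R : realType) (n : nat) (A : groupType) (a : 'I_n -> A).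
Variable fa : free_basis a.
Local Notation T := (ctree R fa).

Definition vdist (u v : A) : R := (wlen a (u^-1 * v)%g)%:R.

Definition pvdist (p : T) (v : A) : R :=
  match p with
  | Vertex u => vdist u v
  | Inner g i x _ =>
      Num.min (x + vdist g v) (1 - x + vdist (g * a i)%g v)
  end.

(* The path metric with edges of length 1: a geodesic between points which do
   not lie in the same open edge passes through end points of their edges. *)
Definition tdist (p q : T) : R :=
  match p, q with
  | Vertex u, _ => pvdist q u
  | _, Vertex v => pvdist p v
  | Inner g i x _, Inner h j y _ =>
      if (g == h) && (i == j) then `|x - y|
      else Num.min (x + pvdist q g) (1 - x + pvdist q (g * a i)%g)
  end.

Lemma vdist_ge0 u v : 0 <= vdist u v.
Proof. exact: ler0n. Qed.

Lemma vdistxx u : vdist u u = 0.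
Proof. by rewrite /vdist mulVg wlen1. Qed.

Lemma vdistC u v : vdist u v = vdist v u.
Proof. by rewrite /vdist -[in LHS](wlenV fa) invgM invgK. Qed.

Lemma vdist_tri v u w : vdist u w <= vdist u v + vdist v w.
Proof.
rewrite /vdist -natrD ler_nat.
have -> : (u^-1 * w = (u^-1 * v) * (v^-1 * w))%g by rewrite !mulgA mulgK.
exact: wlenM.
Qed.

Lemma vdist_eq0 u v : vdist u v = 0 -> u = v.
Proof.
move=> /eqP; rewrite /vdist pnatr_eq0 => /eqP /(wlen_eq0 fa) e.
by apply/esym/(mulgI u^-1%g); rewrite e mulVg.
Qed.

Lemma vdist_edge g i : vdist g (g * a i)%g = 1.
Proof. by rewrite /vdist mulKg wlen_gen. Qed.

Ltac caseMin := repeat match goal with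
  |- context [Num.min ?x ?y] =>
    lazymatch x with context [Num.min _ _] => fail | _ =>
    lazymatch y with context [Num.min _ _] => fail | _ =>
      case: (lerP x y) => ? end end end.

Lemma pvdist_ge0 p v : 0 <= pvdist p v.
Proof.
case: p => [u|g i x /andP[x0 x1]] /=; first exact: vdist_ge0.
have := vdist_ge0 g v; have := vdist_ge0 (g * a i)%g v.
by caseMin; lra.
Qed.

Lemma pvdist_tri v p u : pvdist p u <= pvdist p v + vdist v u.
Proof.
case: p => [w|g i x /andP[x0 x1]] /=; first exact: vdist_tri.
have := vdist_tri v g u; have := vdist_tri v (g * a i)%g u.
by caseMin; lra.
Qed.

Lemma pvdist_tri2 p u v : vdist u v <= pvdist p u + pvdist p v.
Proof.
case: p => [w|g i x /andP[x0 x1]] /=.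
  by rewrite (vdistC w u); exact: vdist_tri.
have := vdist_edge g i.
have := vdist_tri g u v; have := vdist_tri (g * a i)%g u v.
have := vdist_tri (g * a i)%g g u; have := vdist_tri (g * a i)%g g v.
have := vdist_tri g (g * a i)%g u; have := vdist_tri g (g * a i)%g v.
rewrite (vdistC u g) (vdistC u (g * a i)%g) (vdistC (g * a i)%g g).
by caseMin; lra.
Qed.

Definition tdist0 (p q : T) : R :=
  match p with
  | Vertex u => pvdist q u
  | Inner g i x _ => Num.min (x + pvdist q g) (1 - x + pvdist q (g * a i)%g)
  end.

Variant tdist_spec (p q : T) : R -> Type :=
  | TdistSame g i x y hx hy of p = Inner g i x hx & q = Inner g i y hy :
      tdist_spec p q `|x - y|
  | TdistDiff of tdist p q = tdist0 p q : tdist_spec p q (tdist0 p q).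

Lemma tdistP p q : tdist_spec p q (tdist p q).
Proof.
case: p q => [u|g i x hx] [v|h j y hy].
- exact: TdistDiff.
- exact: TdistDiff.
- have E : tdist (Inner g i x hx) (Vertex v) = tdist0 (Inner g i x hx) (Vertex v).
    by rewrite /= (vdistC v) (vdistC v).
  by rewrite E; exact: TdistDiff.
- have [/andP[/eqP e1 /eqP e2]|ne] := boolP ((g == h) && (i == j)).
    subst h j.
    have -> : tdist (Inner g i x hx) (Inner g i y hy) = `|x - y|.
      by rewrite /tdist !eqxx.
    exact: TdistSame.
  have E : tdist (Inner g i x hx) (Inner h j y hy) =
           tdist0 (Inner g i x hx) (Inner h j y hy).
    by rewrite /tdist (negbTE ne).
  by rewrite E; exact: TdistDiff.
Qed.

Lemma tdist0C p q : tdist0 p q = tdist0 q p.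
Proof.
case: p q => [u|g i x hx] [v|h j y hy] /=.
- exact: vdistC.
- by rewrite (vdistC u) (vdistC u).
- by rewrite (vdistC v) (vdistC v).
- rewrite (vdistC h g) (vdistC (h * a j)%g g) (vdistC h (g * a i)%g).
  rewrite (vdistC (h * a j)%g (g * a i)%g).
  by caseMin; lra.
Qed.

Lemma tdist_same g i x y hx hy :
  tdist (Inner g i x hx) (Inner g i y hy) = `|x - y|.
Proof. by rewrite /tdist !eqxx. Qed.

Lemma tdistC p q : tdist p q = tdist q p.
Proof.
have [g i x y hx hy -> ->|e1] := tdistP p q; first by rewrite tdist_same distrC.
have [g i x y hx hy eq ep|e2] := tdistP q p; last exact: tdist0C.
by rewrite -e1 ep eq tdist_same distrC.
Qed.

Lemma tdist_le0 p q : tdist p q <= tdist0 p q.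
Proof.
have [g i x y /= hx hy -> ->|_] := tdistP p q; last by [].
rewrite /= vdistxx (vdistC (g * a i)%g g) vdistxx vdist_edge.
move: hx hy => /andP[? ?] /andP[? ?].
by caseMin; case: (ger0P (x - y)) => ?; lra.
Qed.

Lemma tdist0_le p q v : pvdist p v <= tdist0 p q + pvdist q v.
Proof.
case: p => [u|g i x hx] /=; first exact: pvdist_tri2.
have := pvdist_tri2 q g v; have := pvdist_tri2 q (g * a i)%g v.
by caseMin; lra.
Qed.

Lemma tdist_le p q v : pvdist p v <= tdist p q + pvdist q v.
Proof.
have [g i x y hx hy -> -> /=|_] := tdistP p q; last exact: tdist0_le.
by caseMin; case: (ger0P (x - y)) => ?; lra.
Qed.

Lemma tdist0_tri q p r : tdist0 p r <= tdist0 p q + tdist q r.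
Proof.
case: p => [u|g i x hx] /=.
  by have := tdist_le r q u; rewrite (tdistC r q) addrC.
have := tdist_le r q g; have := tdist_le r q (g * a i)%g.
by rewrite (tdistC r q); caseMin; lra.
Qed.

Lemma tdist_tri q p r : tdist p r <= tdist p q + tdist q r.
Proof.
have [g i x y hx hy ep eq|e1] := tdistP p q; last first.
  by apply: le_trans (tdist_le0 _ _) _; exact: tdist0_tri.
have [h j y' z hy' hz eq' er|e2] := tdistP q r; last first.
  apply: le_trans (tdist_le0 _ _) _; rewrite tdist0C (tdist0C q) addrC.
  by apply: le_trans (tdist0_tri q _ _) _; rewrite lerD2l tdistC ep eq tdist_same.
move: eq'; rewrite eq => -[eg ei ey]; subst h j y'.
by rewrite ep er tdist_same; exact: ler_distD.
Qed.

Lemma tdistxx p : tdist p p = 0.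
Proof.
case: p => [u|g i x hx]; first exact: vdistxx.
by rewrite tdist_same subrr normr0.
Qed.

Lemma tdist_eq0 p q : tdist p q = 0 -> p = q.
Proof.
have [g i x y hx hy -> -> /normr0_eq0/subr0_eq e|_] := tdistP p q.
  by subst y; rewrite (Prop_irrelevance hx hy).
case: p q => [u|g i x hx] [v|h j y hy] /=.
- by move=> /vdist_eq0 ->.
- have /andP[? ?] := hy.
  have := vdist_ge0 h u; have := vdist_ge0 (h * a j)%g u.
  by caseMin => ? ? ?; exfalso; lra.
- have /andP[? ?] := hx.
  have := vdist_ge0 v g; have := vdist_ge0 v (g * a i)%g.
  by caseMin => ? ? ?; exfalso; lra.
- have /andP[? ?] := hx.
  have := pvdist_ge0 (Inner h j y hy) g.
  have := pvdist_ge0 (Inner h j y hy) (g * a i)%g => /=.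
  move: (Num.min (y + vdist h g) _) (Num.min (y + vdist h _) _) => m1 m2.
  by caseMin => ? ? ?; exfalso; lra.
Qed.

HB.instance Definition _ :=
  isMetric.Build R (ctree R fa) tdistxx tdist_eq0 tdistC tdist_tri.

Definition tmul (g : A) (p : T) : T :=
  match p with
  | Vertex u => Vertex (g * u)%g
  | Inner u i x hx => Inner (g * u)%g i x hx
  end.

Lemma vdist_mul g u v : vdist (g * u)%g (g * v)%g = vdist u v.
Proof. by rewrite /vdist invgM -mulgA mulKg. Qed.

Lemma pvdist_mul g p v : pvdist (tmul g p) (g * v)%g = pvdist p v.
Proof. by case: p => [u|u i x hx] /=; rewrite -?(mulgA g) !vdist_mul. Qed.

Lemma tmul_isom g p q : mdist (tmul g p) (tmul g q) = mdist p q.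
Proof.
change (tdist (tmul g p) (tmul g q) = tdist p q).
case: p q => [u|u i x hx] [v|v j y hy].
- exact: vdist_mul.
- exact: (pvdist_mul g (Inner v j y hy)).
- exact: (pvdist_mul g (Inner u i x hx)).
- rewrite /tdist /tmul (inj_eq (mulgI g)).
  by rewrite -!(pvdist_mul g (Inner v j y hy)) (mulgA g).
Qed.

End CayleyTree.

Section Discs.
Variables (R : realType) (n : nat).

Definition sqnorm (x : 'rV[R]_n) : R := \sum_(i < n) x ord0 i ^+ 2.
Definition disc : set 'rV[R]_n := [set x | sqnorm x <= 1].
Definition open_disc : set 'rV[R]_n := [set x | sqnorm x < 1].
Definition sphere : set 'rV[R]_n := [set x | sqnorm x = 1].

End Discs.

(* Whitehead's definition, by characteristic maps. *)
Record cw_complex (R : realType) (Y : topologicalType) := CWComplex {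
  cell : Type;
  cdim : cell -> nat;
  (* characteristic maps; only the values on [disc] matter *)
  cmap : forall i, 'rV[R]_(cdim i) -> Y;
  ocell := fun i => cmap (i := i) @` @open_disc R (cdim i);
  cw_hausdorff : hausdorff_space Y;
  cw_continuous : forall i,
    {within @disc R (cdim i), continuous (cmap (i := i))};
  (* [cmap i] restricts to a homeomorphism from the open disc to [ocell i] *)
  cw_homeo : forall i, exists2 inv : Y -> 'rV[R]_(cdim i),
    {within ocell i, continuous inv}
    & {in @open_disc R (cdim i), cancel (cmap (i := i)) inv};
  cw_disjoint : trivIset setT ocell;
  cw_cover : \bigcup_i ocell i = setT;
  cw_boundary : forall i, exists J : set cell,
    [/\ finite_set J, (forall j, J j -> (cdim j < cdim i)%N)
      & cmap (i := i) @` @sphere R (cdim i) `<=` \bigcup_(j in J) ocell j];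
  cw_weak : forall Z : set Y,
    (forall i, closed (Z `&` closure (ocell i))) -> closed Z }.

Section CW.
Variables (R : realType) (Y : topologicalType) (C : cw_complex R Y).

Definition subcomplex (Z : set Y) : Prop :=
  exists2 J : set (cell C), Z = \bigcup_(j in J) ocell j
    & forall j, J j -> closure (ocell j) `<=` Z.

Definition largest_subcomplex (W : set Y) : set Y :=
  \bigcup_(Z in [set Z | subcomplex Z /\ Z `<=` W]) Z.

End CW.

(* [G] is discrete, so a [G]-CW-structure is a CW-structure whose open cells
   are permuted by [G], an element stabilising a cell fixing it pointwise. *)
Record gcw_complex (R : realType) (G : groupType) (Y : topologicalType) :=
  GCWComplex {
  gcw_cw :> cw_complex R Y;
  gcw_act : gaction G Y;
  gcw_continuous : forall g, continuous (gcw_act g);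
  gcw_permute : forall g (i : cell gcw_cw), exists j : cell gcw_cw,
    gcw_act g @` ocell i = ocell j;
  gcw_rigid : forall g (i : cell gcw_cw), gcw_act g @` ocell i = ocell i ->
    forall y, ocell i y -> gcw_act g y = y }.

Definition free_action (G : groupType) (Y : Type) (act : gaction G Y) : Prop :=
  forall g y, act g y = y -> g = 1%g.

Definition contractible (R : realType) (Y : topologicalType) : Prop :=
  exists (y0 : Y) (H : R * Y -> Y),
    [/\ {within `[0, 1] `*` [set: Y], continuous H},
        forall y, H (0, y) = y & forall y, H (1, y) = y0].

Section Orbits.
Local Open Scope quotient_scope.
Variables (G : groupType) (Y : topologicalType) (act : gaction G Y).

Definition orbit_rel : rel Y := fun x y => `[< exists g, act g x = y >].

Lemma orbit_refl : reflexive orbit_rel.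
Proof. by move=> x; apply/asboolP; exists 1%g; rewrite gact1. Qed.

Lemma orbit_sym : symmetric orbit_rel.
Proof.
suff s x y : orbit_rel x y -> orbit_rel y x by move=> x y; apply/idP/idP; exact: s.
move=> /asboolP[g <-]; apply/asboolP; exists g^-1%g.
by rewrite -gactM mulVg gact1.
Qed.

Lemma orbit_trans : transitive orbit_rel.
Proof.
move=> y x z /asboolP[g <-] /asboolP[h <-]; apply/asboolP; exists (h * g)%g.
by rewrite gactM.
Qed.

Canonical orbit_equiv := EquivRel orbit_rel orbit_refl orbit_sym orbit_trans.

Definition orbit_space : topologicalType :=
  quotient_topology {eq_quot orbit_equiv}.

(* [Y -> Y/G] is open, so for a [G]-invariant [L] the quotient topology on
   [L/G] is the topology induced from [Y/G]. *)
Definition cocompact (L : set Y) : Prop :=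
  (forall g y, L y -> L (act g y)) /\
  compact ((\pi_{eq_quot orbit_equiv} : Y -> orbit_space) @` L).

End Orbits.

Section Horoballs.
Variables (R : realType) (M : metricType R).

(* A ray is given by a function on [R] of which only the values on
   [[0, +oo[] matter. *)
Definition geodesic_ray (tau : R -> M) : Prop :=
  forall s t, 0 <= s -> 0 <= t -> mdist (tau s) (tau t) = `|s - t|.

Definition horoball (tau : R -> M) (s : R) : set M :=
  [set p | exists2 l, Num.max 0 s <= l & mdist (tau l) p <= l - s].

End Horoballs.

Definition joined_in (R : realType) (Y : topologicalType) (W : set Y) (x y : Y)
    : Prop :=
  exists f : R -> Y,
    [/\ {within `[0, 1], continuous f}, f 0 = x, f 1 = y & f @` `[0, 1] `<=` W].

Record isom_action (R : realType) (G : groupType) (M : metricType R) :=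
  IsomAction {
  isom_act :> gaction G M;
  isom_actP : forall g p q, mdist (isom_act g p) (isom_act g q) = mdist p q }.

Section Sigma.
Variables (R : realType) (G : groupType) (M : metricType R).
Variable rho : isom_action G M.

Section ControlMap.
Variables (Y : topologicalType) (C : gcw_complex R G Y) (h : Y -> M).

Definition Yray (tau : R -> M) (s : R) : set Y :=
  largest_subcomplex C (h @^-1` horoball tau s).

Definition controlled_connected (tau : R -> M) : Prop :=
  forall L, cocompact (gcw_act C) L ->
  exists L', [/\ cocompact (gcw_act C) L', L `<=` L'
    & forall s, exists2 lam, 0 <= lam
      & (forall x y, (Yray tau s `&` L) x -> (Yray tau s `&` L) y ->
           joined_in R (Yray tau (s - lam) `&` L') x y)
        /\
        (forall x y, (Yray tau (s + lam) `&` L) x ->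
                     (Yray tau (s + lam) `&` L) y ->
           joined_in R (Yray tau s `&` L') x y)].

End ControlMap.

(* A point of the boundary is given by a ray representing it.  The choice of
   the control map is existentially quantified, so that non-membership asserts
   the failure of controlled connectedness for every control map. *)
Definition Sigma1 : set (R -> M) := [set tau | geodesic_ray tau /\
  exists (Y : topologicalType) (C : gcw_complex R G Y) (h : Y -> M),
    [/\ [set: Y] !=set0, free_action (gcw_act C), contractible R Y,
        continuous h /\ (forall g y, h (gcw_act C g y) = rho g (h y))
      & controlled_connected C h tau]].

End Sigma.

Section TreeAction.
Variables (R : realType) (n : nat) (A B : groupType) (a : 'I_n -> A).
Variables (fa : free_basis a) (phi : aut_action A B).

Definition tree_act_fun (g : sdprod phi) : ctree R fa -> ctree R fa :=
  tmul (sdr g).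

Lemma tree_act1 p : tree_act_fun 1%g p = p.
Proof. by case: p => [u|u i x hx]; rewrite /tree_act_fun /= mul1g. Qed.

Lemma tree_actM g h p :
  tree_act_fun (g * h)%g p = tree_act_fun g (tree_act_fun h p).
Proof. by case: p => [u|u i x hx]; rewrite /tree_act_fun /= mulgA. Qed.

Definition tree_action : isom_action (sdprod phi) (ctree R fa) :=
  IsomAction (isom_act := GAction tree_act1 tree_actM)
    (fun g => tmul_isom (sdr g)).

End TreeAction.

(* [tau] is the ray of the infinite word [c 0, c 1, ...]. *)
Definition ray_of_word (R : realType) (n : nat) (A : groupType)
    (a : 'I_n -> A) (fa : free_basis a) (c : nat -> letter n)
    (tau : R -> ctree R fa) : Prop :=
  geodesic_ray tau /\ forall k : nat, tau k%:R = Vertex (wval a (mkseq c k)).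

(* Main.v *)
Require Import Defs.
From mathcomp Require Import all_boot all_order all_algebra.
From mathcomp Require Import all_classical all_reals all_analysis.
From mathcomp Require Import generic_quotient lra zify.

(** A control map for which [tau] is controlled connected makes [B] finitely
generated over the elements of [A] that are vertices of some horoball at the
end of [tau]; on such a horoball the exponent sum of [t] is bounded above when
[tau] ends in [t^-1], which contradicts the hypothesis on [B].

For the first claim, let [Y] be the free [G]-CW-complex, pick a point [y0] of
[Y] which is a cell, and let [L] be its orbit. The group [B] acts trivially on
the tree, so all points [b y0] lie over the same point of the tree and in the
same [Yray tau s]; controlled connectedness joins [y0] to each of them by a
path inside one cocompact set [L'] and over one horoball, both independent of
[b]. Since [L'] is cocompact, it is covered by the translates of a finite union
[U] of open cells ([cocompact_finite_cells]). Freeness and closure-finiteness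
leave only a finite set [F] of elements [f] such that [f U] meets the closure
of [U] ([finite_adjacent]). A path is compact and connected, so it meets
finitely many translates [g U], any two of which are linked by steps
[g, g f, ...] with [f] or its inverse in [F] ([connected_translates]). If
[g = (b, a)] and [f = (s, u)], then [g f = (b (phi a s), a u)]: a step changes
the [B]-component by some [phi a s] or its inverse, where [s] is a
[B]-component of an element of [F] and [a] is the [A]-component of a translate
met by the path. As [U] has bounded image in the tree, [a] is a vertex of a
slightly larger horoball. Hence the elements [phi a s] generate [B].

The bound on the exponent sum is [horoball_expsum]. *)

Set Implicit Arguments.
Unset Strict Implicit.
Unset Printing Implicit Defensive.

Import Order.TTheory GRing.Theory Num.Theory.
Import numFieldNormedType.Exports.

Local Open Scope classical_set_scope.
Local Open Scope ring_scope.

(** * Finite sets and compactness *)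

Lemma infinite_sequence (T : Type) (X : set T) :
  infinite_set X -> exists2 x : nat -> T, injective x & forall n, X (x n).
Proof.
move=> /infiniteP /card_leP[f].
have nT (n : nat) : n \in [set: nat] by rewrite inE.
exists (fun n => val (f (exist _ n (nT n)))).
  by move=> m n /val_inj e; have [] := inj (in_setT _) (in_setT _) e.
by move=> n; exact/set_mem/valP.
Qed.

Lemma finite_subset1 (T : Type) (X : set T) : is_subset1 X -> finite_set X.
Proof.
move=> X1; have [->|/set0P[x Xx]] := eqVneq X set0; first exact: finite_set0.
by apply: sub_finite_set (finite_set1 x) => y Xy; exact: X1.
Qed.

(** In a compact set the tails of a sequence cluster somewhere, and a closed
tail contains its cluster points. *)
Lemma compact_closed_tails (Z : topologicalType) (K : set Z) (z : nat -> Z) :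
  compact K -> (forall n, K (z n)) ->
  (forall N, closed (z @` [set n | (N <= n)%N])) ->
  exists p, forall N, exists2 n, (N <= n)%N & z n = p.
Proof.
move=> cK Kz ctail.
have [p [_ clp]] : (K `&` cluster (z @ \oo)) !=set0.
  by apply: cK; exists 0%N => // n _; exact: Kz.
exists p => N; apply: ctail => W nW; apply: clp => //.
by exists N => // n Nn; exists n.
Qed.

Lemma compact_ubounded (R : realType) (Y : topologicalType) (q : Y -> R)
    (K : set Y) : continuous q -> compact K -> exists D, forall y, K y -> q y <= D.
Proof.
move=> cq cK; have [->|/set0P K0] := eqVneq K set0; first by exists 0.
have [|p _ pmax] := compact_EVT_max K0 cK (f := q).
  exact: continuous_subspaceT.
by exists (q p) => y Ky; apply: pmax; rewrite inE.
Qed.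

Lemma mdist_continuous (R : realType) (M : metricType R) (v : M) :
  continuous (fun p : M => mdist p v).
Proof.
move=> p; apply/cvgrPdist_lt => e e0.
have := nbhsx_ballx p e e0; rewrite ballEmdist; apply: filterS => q /= pq.
have := metric_triangle p q v; have := metric_triangle q p v.
rewrite (metric_sym q p) ltr_distl => ? ?; apply/andP; split; lra.
Qed.

Section Discs.
Variables (R : realType) (n : nat).

Lemma sqnorm_continuous : continuous (@sqnorm R n).
Proof.
rewrite /sqnorm; elim: (index_enum _) => [|i r IH].
  have -> : (fun x : 'rV[R]_n => \sum_(i <- [::]) x ord0 i ^+ 2) = cst 0.
    by apply/funext => x; rewrite big_nil.
  exact: cst_continuous.
have -> : (fun x : 'rV[R]_n => \sum_(j <- i :: r) x ord0 j ^+ 2) =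
    fun x => x ord0 i * x ord0 i + \sum_(j <- r) x ord0 j ^+ 2.
  by apply/funext => x; rewrite big_cons.
move=> x; apply: (@continuousD R _ _ (fun x : 'rV[R]_n => x ord0 i * x ord0 i)
  (fun x : 'rV[R]_n => \sum_(j <- r) x ord0 j ^+ 2)); last exact: IH.
by apply: continuousM; exact: coord_continuous.
Qed.

Lemma disc_compact : compact (@disc R n).
Proof.
have cI : compact [set v : 'rV[R]_n | forall i, v ord0 i \in `[-1, 1]].
  by apply: (@rV_compact R n (fun=> `[-1, 1]%classic)) => _; exact: segment_compact.
apply: subclosed_compact cI _ => [|x /= x1 i].
  exact: (proj1 (continuous_closedP _) sqnorm_continuous _ (@closed_le R 1)).
rewrite in_itv /= -ler_norml -(@expr_le1 _ 2) // real_normK ?num_real //.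
apply: le_trans x1; rewrite /sqnorm (bigD1 i) //= lerDl.
by apply: sumr_ge0 => j _; exact: sqr_ge0.
Qed.

Lemma open_disc0 : @open_disc R n 0.
Proof.
by rewrite /open_disc /= /sqnorm big1 // => i _; rewrite mxE expr0n.
Qed.

Lemma disc_split x : @disc R n x -> open_disc x \/ sphere x.
Proof. by rewrite /disc /= le_eqVlt => /orP[/eqP|]; [right|left]. Qed.

End Discs.

(** * Cells of a CW-complex *)

Section CW.
Variables (R : realType) (Y : topologicalType) (C : cw_complex R Y).
Implicit Types i j : cell C.

Lemma cell_of y : exists i, ocell i y.
Proof.
have [i _ iy] : (\bigcup_i @ocell R Y C i) y by rewrite cw_cover.
by exists i.
Qed.

Lemma ocell_eq i j y : ocell i y -> ocell j y -> i = j.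
Proof. by move=> iy jy; have := @cw_disjoint R Y C i j I I; apply; exists y. Qed.

Lemma closed_cell_compact i : compact (@cmap R Y C i @` @disc R (cdim i)).
Proof. by apply: continuous_compact (@disc_compact R _); exact: cw_continuous. Qed.

Lemma closure_ocell_sub i : closure (ocell i) `<=` @cmap R Y C i @` @disc R (cdim i).
Proof.
have /closure_id -> : closed (@cmap R Y C i @` @disc R (cdim i)).
  by apply: compact_closed; [exact: (@cw_hausdorff R Y C) | exact: closed_cell_compact].
by apply: closureS => y [x x1 <-]; exists x => //; exact: ltW.
Qed.

Lemma closure_finite i :
  exists2 J : set (cell C), finite_set J &
    closure (ocell i) `<=` \bigcup_(j in J) ocell j.
Proof.
have [J [fJ _ bJ]] := cw_boundary i; exists (i |` J).
  by rewrite finite_setU; split => //; exact: finite_set1.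
move=> y /closure_ocell_sub [x /disc_split [x1 <-|x1 <-]].
  by exists i; [left | exists x].
by have [|j Jj jy] := bJ (@cmap R Y C i x); [exists x | exists j => //; right].
Qed.

Lemma closure_bigcup_finite (J : set (cell C)) : finite_set J ->
  exists2 J' : set (cell C), finite_set J' &
    closure (\bigcup_(i in J) ocell i) `<=` \bigcup_(j in J') ocell j.
Proof.
move=> fJ.
have /choice[N NP] i : exists N : set (cell C), finite_set N /\
    closure (ocell i) `<=` \bigcup_(j in N) ocell j.
  by have [N ? ?] := closure_finite i; exists N.
exists (\bigcup_(i in J) N i); first by apply: bigcup_finite => // i _; have [] := NP i.
have cl : closed (\bigcup_(i in J) closure (ocell i)).
  by apply: (closed_bigcup (I := {classic cell C})) => // i _; exact: closed_closure.
move=> y; rewrite bigcup_bigcup => Jy.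
have [i Ji iy] : (\bigcup_(i in J) closure (ocell i)) y.
  apply: cl; apply: closureS Jy => z [i Ji iz]; exists i => //.
  exact: subset_closure.
by exists i => //; have [_] := NP i; apply.
Qed.

(** A set meeting each open cell in finitely many points meets each closed
cell in finitely many points, hence in a closed set. *)
Lemma locally_finite_closed (Z : set Y) :
  (forall i, finite_set (Z `&` ocell i)) -> closed Z.
Proof.
move=> Zf; apply: (cw_weak (c := C)) => i.
have [J fJ iJ] := closure_finite i.
have /accessible_finite_set_closed := hausdorff_accessible (@cw_hausdorff R Y C); apply.
apply: (@sub_finite_set _ _ (\bigcup_(j in J) (Z `&` ocell j))).
  by move=> y [Zy /iJ [j Jj jy]]; exists j.
exact: bigcup_finite.
Qed.

(** Images of a sequence spread over infinitely many cells leave every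
compact set: its tails have closed preimages, so they would cluster at one of
their own members infinitely often. The identity is the case of a compact subset of
[Y], the orbit map that of a cocompact one. *)
Lemma compact_no_spread (Z : topologicalType) (f : Y -> Z) (K : set Z)
    (x : nat -> Y) :
  (forall X : set Z, closed (f @^-1` X) -> closed X) ->
  compact K -> (forall n, K (f (x n))) ->
  (forall i n, finite_set [set y | ocell i y /\ f y = f (x n)]) ->
  ~ forall i, finite_set [set n | exists2 y, ocell i y & f y = f (x n)].
Proof.
move=> fcl cK Kx fib fin.
have [N|p pinf] := compact_closed_tails cK Kx.
  apply: fcl; apply: locally_finite_closed => i.
  apply: (sub_finite_set _ (bigcup_finite (fin i) (fun n _ => fib i n))).
  by move=> y [[n Nn /esym e] iy]; exists n => //; exists y.
have [m _ fm] := pinf 0%N; have [i ix] := cell_of (x m).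
have /finite_seqP[S eS] := fin i.
have [n Sn fn] := pinf (\max_(k <- S) k).+1.
have nS : [set` S] n by rewrite -eS; exists (x m); rewrite // fm fn.
by move: Sn; rewrite ltnNge (leq_bigmax_seq (F := id)).
Qed.

(** A cell of least dimension has no boundary, so it is a point. *)
Lemma exists_vertex : [set: Y] !=set0 -> exists i y, ocell i = [set y].
Proof.
move=> [y0 _]; have [i0 _] := cell_of y0.
have [d [i di] dmin] : exists2 d, (exists i, cdim i = d)
    & forall i, (d <= cdim i)%N.
  have e : exists d, `[< exists i, cdim i = d >].
    by exists (cdim i0); apply/asboolP; exists i0.
  case: (ex_minnP e) => d /asboolP[i di] dmin; exists d; first by exists i.
  by move=> j; apply/dmin/asboolP; exists j.
have d0 : cdim i = 0%N.
  have [J [_ Jlt bJ]] := cw_boundary i.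
  case: (cdim i =P 0%N) => // /eqP; rewrite -lt0n => di0.
  have [|j Jj _] := bJ (@cmap R Y C i (delta_mx ord0 (Ordinal di0))).
    exists (delta_mx ord0 (Ordinal di0)) => //.
    rewrite /sphere /= /sqnorm (bigD1 (Ordinal di0)) //= mxE !eqxx expr1n.
    by rewrite big1 ?addr0 // => k kn; rewrite mxE (negbTE kn) andbF expr0n.
  by have := Jlt j Jj; rewrite ltnNge di dmin.
exists i, (@cmap R Y C i 0); apply/seteqP; split => [y [x _ <-]|y ->].
  by congr cmap; apply/rowP => -[k kd]; exfalso; move: kd; rewrite d0.
by exists 0 => //; exact: open_disc0.
Qed.

End CW.

(** * Translates of a finite set of cells *)

Section GCW.
Variables (R : realType) (G : groupType) (Y : topologicalType).
Variable C : gcw_complex R G Y.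
Implicit Types (i j : cell C) (g : G) (P U : set Y).
Local Notation act := (gcw_act C).

Lemma actK g y : act g^-1%g (act g y) = y.
Proof. by rewrite -gactM mulVg gact1. Qed.

Lemma actVK g y : act g (act g^-1%g y) = y.
Proof. by rewrite -gactM mulgV gact1. Qed.

Lemma act_ocell g i j y : ocell i y -> ocell j (act g y) -> act g @` ocell i = ocell j.
Proof.
have [k ek] := gcw_permute g i => iy jgy.
have kgy : ocell k (act g y) by rewrite -ek; exists y.
by rewrite ek (ocell_eq kgy jgy).
Qed.

Lemma act_stab_ocell g i y : ocell i y -> ocell i (act g y) -> act g y = y.
Proof. by move=> iy igy; exact: gcw_rigid (act_ocell iy igy) _ iy. Qed.

(** The union of the cells in the orbit of the cell [i]. Being a set of points,
it identifies the orbit without a choice of indices. *)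
Definition saturation i : set Y := [set y | exists g, ocell i (act g y)].

Lemma saturation_eq i j y : saturation i y -> saturation j y ->
  saturation i = saturation j.
Proof.
suff sub k l : saturation k y -> saturation l y -> saturation k `<=` saturation l.
  by move=> iy jy; apply/seteqP; split; exact: sub.
move=> [g ky] [h ly] z [g' kz].
have lhg : ocell l (act (h * g^-1)%g (act g y)) by rewrite gactM actK.
exists (h * g^-1 * g')%g; rewrite gactM -(act_ocell ky lhg).
by exists (act g' z).
Qed.

Lemma orbit_closed_preimage (X : set (orbit_space act)) :
  closed ((\pi_(orbit_space act))%qT @^-1` X) -> closed X.
Proof. by rewrite -!openC. Qed.

(** Points of [L] chosen in infinitely many orbits of cells would be spread out
in the sense of [compact_no_spread], because by rigidity an orbit of points
meets a cell at most once. *)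
Lemma cocompact_finite_saturations L : cocompact act L ->
  finite_set [set saturation i | i in [set i | saturation i `&` L !=set0]].
Proof.
move=> [Linv cL]; apply: contrapT => /infinite_sequence[F Finj FP].
have /choice[x xP] n : exists y, exists i, [/\ F n = saturation i, ocell i y & L y].
  have [i [y [[g iy] Ly]] <-] := FP n.
  by exists (act g y), i; split => //; exact: Linv.
have piP y z : (\pi_(orbit_space act) y)%qT = (\pi_(orbit_space act) z)%qT ->
    exists g, y = act g z.
  move=> /esym e; suff /asboolP[g <-] : orbit_rel act z y by exists g.
  by apply/(@eqmodP _ (orbit_equiv act)).
apply: (compact_no_spread (C := C) (f := (\pi_(orbit_space act))%qT) (x := x)) cL _ _ _.
- exact: orbit_closed_preimage.
- by move=> n; exists (x n) => //; have [i []] := xP n.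
- move=> i n; apply: finite_subset1 => y z [iy yx] [iz zx].
  have [g eg] : exists g, y = act g z by apply: piP; rewrite yx zx.
  by rewrite eg (act_stab_ocell iz) // -eg.
- move=> i; apply: finite_subset1 => m n [y iy ym] [z iz zn].
  have sat k w : ocell i w ->
      (\pi_(orbit_space act) w)%qT = (\pi_(orbit_space act) (x k))%qT ->
      F k = saturation i.
    move=> iw /piP[g ew]; have [j [-> jx _]] := xP k.
    apply: (@saturation_eq _ _ (x k)); first by exists 1%g; rewrite gact1.
    by exists g; rewrite -ew.
  by apply: Finj; rewrite (sat m y) // (sat n z).
Qed.

Lemma cocompact_finite_cells L : cocompact act L ->
  exists2 J : set (cell C), finite_set J &
    forall y, L y -> exists g, (\bigcup_(i in J) ocell i) (act g^-1%g y).
Proof.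
move=> cL; pose D := [set i | saturation i `&` L !=set0].
have [[i0 _]|noi] := pselect (exists i, D i); last first.
  exists set0 => [|y Ly]; first exact: finite_set0.
  have [i iy] := cell_of C y; case: noi; exists i, y; split => //.
  by exists 1%g; rewrite gact1.
have /choice[r rP] X : exists i, (saturation @` D) X -> saturation i = X.
  by have [[i _ <-]|nX] := pselect ((saturation @` D) X); [exists i | exists i0].
exists (r @` (saturation @` D)).
  exact/finite_image/cocompact_finite_saturations.
move=> y Ly; have [i iy] := cell_of C y.
have siy : saturation i y by exists 1%g; rewrite gact1.
have DX : (saturation @` D) (saturation i) by exists i => //; exists y.
have [g riy] : saturation (r (saturation i)) y by rewrite rP.
by exists g^-1%g, (r (saturation i)); [exists (saturation i) | rewrite invgK].
Qed.

Hypothesis freeC : free_action (gcw_act C).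

(** Two elements carrying one cell to another differ by an element that
stabilises a cell, hence fixes its points, hence is trivial. *)
Lemma cell_carrier_unique i j :
  is_subset1 [set g | exists2 y, ocell j y & ocell i (act g y)].
Proof.
move=> g h [y jy igy] [z jz ihz].
have [w jw ew] : (act h @` ocell j) (act g y).
  by rewrite (act_ocell jz ihz).
have e : act (h^-1 * g)%g y = w by rewrite gactM -ew actK.
have /freeC e1 : act (h^-1 * g)%g y = y.
  by apply: act_stab_ocell jy _; rewrite e.
by apply/(mulgI h^-1%g); rewrite e1 mulVg.
Qed.

Section Translates.
Variable J : set (cell C).
Hypothesis finJ : finite_set J.
Local Notation U := (\bigcup_(i in J) ocell i).

Lemma finite_translates_cell j :
  finite_set [set g | exists2 y, ocell j y & U (act g^-1%g y)].
Proof.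
apply: (@sub_finite_set _ _ (\bigcup_(i in J)
    [set g | exists2 y, ocell j y & ocell i (act g^-1%g y)])).
  by move=> g [y jy [i Ji iy]]; exists i => //; exists y.
apply: bigcup_finite => // i Ji; apply: finite_subset1 => g h gP hP.
exact/invg_inj/(@cell_carrier_unique i j).
Qed.

(** The closure of [U] lies in finitely many open cells, and by freeness each
of these comes from each cell of [U] by at most one group element. *)
Lemma finite_adjacent :
  finite_set [set g | exists2 y, closure U y & U (act g^-1%g y)].
Proof.
have [J' fJ' UJ'] := closure_bigcup_finite finJ.
apply: (sub_finite_set _ (bigcup_finite fJ' (fun j _ => finite_translates_cell j))).
by move=> g [y /UJ'[j Jj jy] Uy]; exists j => //; exists y.
Qed.

Lemma compact_finite_translates P : compact P ->
  finite_set [set g | exists2 y, P y & U (act g^-1%g y)].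
Proof.
move=> cP; apply: contrapT => /infinite_sequence[g ginj gP].
have /choice[x xP] n : exists y, P y /\ U (act (g n)^-1%g y).
  by have [y ? ?] := gP n; exists y.
apply: (compact_no_spread (C := C) (f := id) (x := x)) cP _ _ _.
- by [].
- by move=> n; have [] := xP n.
- by move=> i n; apply: finite_subset1 => y z [_ ->] [_ ->].
- move=> i; apply: sub_finite_set (finite_preimage _ (finite_translates_cell i)).
    by move=> n [y iy /= e]; exists (x n); [rewrite -e | exact: (xP n).2].
  by move=> m n _ _; exact: ginj.
Qed.

Lemma closed_translate g : closed [set y | closure U (act g^-1%g y)].
Proof.
have /continuous_closedP act_closed := @gcw_continuous _ _ _ C g^-1%g.
exact: (act_closed _ (@closed_closure _ U)).
Qed.

(** Only finitely many translates of [U] meet [P], so the closures of those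
whose group element satisfies [Q] have a closed union, and so do the others.
The invariance of [Q] makes these two closed sets disjoint on [P], which is
connected. The adjacency of [g U] and [h U] is expressed after translation by
the inverse of [g]. *)
Lemma connected_translates P (Q : G -> Prop) :
  compact P -> connected P ->
  (forall y, P y -> exists g, U (act g^-1%g y)) ->
  let meets g := exists2 y, P y & U (act g^-1%g y) in
  (forall g h y, meets g -> meets h -> closure U y ->
     U (act (g^-1 * h)^-1%g y) -> (Q g <-> Q h)) ->
  forall g h, meets g -> meets h -> Q g -> Q h.
Proof.
move=> cP connP cov meets adj g h mg mh Qg.
have adj' k l y : meets k -> meets l ->
    closure U (act k^-1%g y) -> U (act l^-1%g y) -> Q k <-> Q l.
  move=> mk ml kcl ly; apply: (adj _ _ (act k^-1%g y)) => //.
  by rewrite invgM invgK gactM actVK.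
pose W (E : set G) := \bigcup_(k in E) [set y | closure U (act k^-1%g y)].
have clW E : E `<=` meets -> closed (W E).
  move=> sE; apply: closed_bigcup => [|k _]; last exact: closed_translate.
  by apply: sub_finite_set sE _; exact: compact_finite_translates.
pose E1 := [set k | meets k /\ Q k]; pose E2 := [set k | meets k /\ ~ Q k].
have E1Q y k : W E1 y -> meets k -> U (act k^-1%g y) -> Q k.
  by move=> [l [ml Ql] lcl] mk ky; apply: (adj' _ _ _ ml mk lcl ky).1.
have E2Q y k : W E2 y -> meets k -> U (act k^-1%g y) -> ~ Q k.
  by move=> [l [ml Ql] lcl] mk ky /(adj' _ _ _ ml mk lcl ky).2.
have sW k (y : Y) E : E k -> U (act k^-1%g y) -> W E y.
  by move=> Ek ky; exists k => //; exact: subset_closure.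
have PW : P `&` W E1 = P.
  apply: connP.
  - by have [y Py gy] := mg; exists y; split => //; exact: sW gy.
  - exists (~` W E2); first by rewrite openC; apply: clW => k [].
    apply/seteqP; split => y [Py Wy]; split => //.
      have [k ky] := cov y Py; have mk : meets k by exists y.
      by move=> W2; exact: (E2Q _ _ W2 mk ky) (E1Q _ _ Wy mk ky).
    have [k ky] := cov y Py; have mk : meets k by exists y.
    have [Qk|nQk] := pselect (Q k); first exact: sW ky.
    by case: Wy; exact: sW ky.
  - by exists (W E1) => //; apply: clW => k [].
have [y Py hy] := mh; move: (Py); rewrite -{1}PW => -[_ Wy].
exact: E1Q Wy mh hy.
Qed.

Lemma ubounded_cells (q : Y -> R) : continuous q ->
  exists D, forall y, U y -> q y <= D.
Proof.
move=> cq.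
have /choice[D DP] i : exists D, forall y, ocell i y -> q y <= D.
  have [D DP] := compact_ubounded cq (@closed_cell_compact R Y C i).
  by exists D => y [x x1 <-]; apply: DP; exists x => //; exact: ltW.
have /finite_seqP[s es] := finite_image D finJ.
exists (\big[Num.max/0]_(d <- s) d) => y [i Ji iy].
apply: le_trans (DP i y iy) _; apply: le_bigmax_seq => //.
by have : [set` s] (D i) by rewrite -es; exists i.
Qed.

End Translates.

End GCW.


(** * Exponent sums and horoballs in the Cayley tree *)

Section Expsum.
Variables (n : nat) (A : groupType) (a : 'I_n -> A) (fa : free_basis a).
Variable t : letter n.
Implicit Types (w : seq (letter n)) (g h : A).

Definition word_expsum w : int :=
  (count_mem t w)%:Z - (count_mem (linv t) w)%:Z.

Lemma linv_neq (l : letter n) : (l == linv l) = false.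
Proof. by case: l => i b; apply/eqP => -[]; case: b. Qed.

Lemma word_expsum_cat w w' :
  word_expsum (w ++ w') = word_expsum w + word_expsum w'.
Proof. by rewrite /word_expsum !count_cat !PoszD; lia. Qed.

Lemma word_expsum_cons l w :
  word_expsum (l :: w) = word_expsum [:: l] + word_expsum w.
Proof. exact: (word_expsum_cat [:: l]). Qed.

Lemma word_expsum_linv l : word_expsum [:: linv l] = - word_expsum [:: l].
Proof.
rewrite /word_expsum /= (inj_eq (inv_inj (@linvK n))).
by rewrite (can2_eq (@linvK n) (@linvK n)) opprB !addn0.
Qed.

(** Cancelling a letter against its inverse does not change the exponent sum,
so the exponent sum may be read off any word for [g]. *)
Lemma reduce_expsum w : exists w',
  [/\ reduced w', wval a w' = wval a w & word_expsum w' = word_expsum w].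
Proof.
elim: w => [|l w [w' [rw' vw' sw']]]; first by exists [::].
case: w' rw' vw' sw' => [|l' w'] rw' vw' sw'.
  by exists [:: l]; rewrite !wval_cons vw' (word_expsum_cons l w) -sw' -word_expsum_cons.
have [E|E] := eqVneq l' (linv l); last first.
  exists (l :: l' :: w'); split => /=; first by apply/andP.
    by rewrite !(wval_cons _ l) vw'.
  by rewrite (word_expsum_cons l w) -sw' -word_expsum_cons.
exists w'; split.
- by move: rw'; rewrite /reduced /=; exact: path_sorted.
- by rewrite wval_cons -vw' wval_cons E lval_linv mulgA mulgV mul1g.
- rewrite (word_expsum_cons l w) -sw' (word_expsum_cons l' w') E.
  by rewrite word_expsum_linv addrA subrr add0r.
Qed.

Lemma expsum_wval w : expsum a t (wval a w) = word_expsum w.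
Proof.
have [w' [rw' <- <-]] := reduce_expsum w.
by rewrite /expsum rword_wval.
Qed.

Lemma expsumM g h : expsum a t (g * h)%g = expsum a t g + expsum a t h.
Proof.
have [_ eg] := rwordP fa g; have [_ eh] := rwordP fa h.
by rewrite -eg -eh -wval_cat !expsum_wval word_expsum_cat.
Qed.

Lemma expsum_ge_wlen g : - (wlen a g)%:Z <= expsum a t g.
Proof.
rewrite /expsum /wlen.
have : (count_mem (linv t) (rword a g) <= size (rword a g))%N by exact: count_size.
lia.
Qed.

Variables (R : realType) (c : nat -> letter n) (N : nat).
Hypothesis ct : forall k, (N <= k)%N -> c k = linv t.
Variable tau : R -> ctree R fa.
Hypothesis tauc : ray_of_word c tau.

Lemma expsum_ray j :
  expsum a t (wval a (mkseq c (N + j))) = expsum a t (wval a (mkseq c N)) - j%:Z.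
Proof.
rewrite !expsum_wval; elim: j => [|j IH]; first by rewrite addn0 subr0.
rewrite addnS mkseqS -cats1 word_expsum_cat IH ct ?leq_addr //.
rewrite word_expsum_linv /word_expsum /= eqxx linv_neq; lia.
Qed.

(** Along [tau] the exponent sum of [t] eventually drops by one per unit of
length, as fast as the ball centred at [tau l] in the definition of a horoball
grows; the exponent sum being 1-Lipschitz, the two effects cancel. *)
Lemma horoball_expsum s :
  exists m : int, forall u, horoball tau s (Vertex u) -> expsum a t u < m.
Proof.
have [geo tauk] := tauc; pose M := Num.bound `|s|.
exists (expsum a t (wval a (mkseq c N)) + (N + M)%:Z + 1) => u [l].
rewrite ge_max => /andP[l0 sl] ul.
pose j := Num.bound l; pose v := wval a (mkseq c (N + j)).
have lNj : l < (N + j)%:R.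
  by rewrite natrD (lt_le_trans (archi_boundP l0)) // lerDr.
have wl : (wlen a (u^-1 * v)%g <= N + j + M)%N.
  rewrite -(ler_nat R) [leLHS](_ : _ = mdist (Vertex v : ctree R fa) (Vertex u)) //.
  have := metric_triangle (Vertex v : ctree R fa) (tau l) (Vertex u).
  rewrite -[Vertex v]tauk geo ?ler0n // gtr0_norm ?subr_gt0 // => ?.
  have : `|s| < M%:R by exact: archi_boundP.
  by rewrite ltr_norml => /andP[? ?]; rewrite [leRHS]natrD; lra.
have := expsumM u (u^-1 * v)%g; rewrite mulgA mulgV mul1g expsum_ray.
have := expsum_ge_wlen (u^-1 * v)%g. lia.
Qed.

End Expsum.

(** * Generation of the kernel from paths in a horoball *)

Section Generated.
Variables (G : groupType) (X : set G).

Lemma generated_sub : X `<=` generated X.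
Proof. exact: sub_smallest. Qed.

Lemma generated_subgroup : subgroup_set (generated X).
Proof.
split=> [|x y gx gy|x gx] K KX; have [[K1 KM KV] _] := KX; first exact: K1.
  by apply: KM; [exact: gx | exact: gy].
by apply: KV; exact: gx.
Qed.

Lemma generatedMr x z : generated X z -> generated X (x * z)%g <-> generated X x.
Proof.
have [_ gM gV] := generated_subgroup => gz; split=> gx; last exact: gM.
by rewrite -(mulgK z x); apply: gM => //; exact: gV.
Qed.

End Generated.

Lemma orbit_cocompact (G : groupType) (Y : topologicalType) (act : gaction G Y)
    (y0 : Y) : cocompact act [set y | exists g, y = act g y0].
Proof.
split=> [g y [k ->]|]; first by exists (g * k)%g; rewrite gactM.
rewrite (_ : _ @` _ = [set (\pi_(orbit_space act))%qT y0]); first exact: compact_set1.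
apply/seteqP; split => [_ [y [g ->] <-]|_ ->] /=; last first.
  by exists y0 => //; exists 1%g; rewrite gact1.
apply/(@eqmodP _ (orbit_equiv act)); rewrite /= orbit_sym.
by apply/asboolP; exists g.
Qed.

(** A point which is a cell is closed, so each of its translates is a
subcomplex. *)
Lemma vertex_Yray (R : realType) (G : groupType) (M : metricType R)
    (Y : topologicalType) (C : gcw_complex R G Y) (h : Y -> M)
    (i : cell C) (y0 : Y) (g : G) (tau : R -> M) (s : R) :
  ocell i = [set y0] -> horoball tau s (h (gcw_act C g y0)) ->
  Yray C h tau s (gcw_act C g y0).
Proof.
move=> iy hy; have [j ej] := gcw_permute g i.
exists [set gcw_act C g y0] => //; split; last by move=> _ ->.
move: ej; rewrite iy image_set1 => ej.
exists [set j] => [|_ ->]; first by rewrite bigcup_set1.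
rewrite -ej => y; apply: accessible_closed_set1.
exact: hausdorff_accessible (@cw_hausdorff R Y C).
Qed.

Theorem corollary2 (R : realType) (n : nat) (A : groupType) (a : 'I_n -> A)
    (fa : free_basis a) (B : groupType) (phi : aut_action A B)
    (hG : finitely_generated (sdprod phi)) (t : letter n)
    (hB : ~ exists m : int,
        fg_over phi (~` (expsum a t @^-1` [set k : int | m <= k])))
    (c : nat -> letter n) (hc : reduced_inf c)
    (hct : exists N : nat, forall k : nat, (N <= k)%N -> c k = linv t)
    (tau : R -> ctree R fa) (htau : ray_of_word c tau) :
  ~ Sigma1 (tree_action R fa phi) tau.
Proof.
move=> [_ [Y [C [h [Y0 freeC _ [h_cont h_equiv] ctrl]]]]].
have [N ct] := hct.
have [i0 [y0 i0y0]] := exists_vertex C Y0.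
have [L' [cL' LL' /(_ (- mdist (tau 0) (h y0)))]] :=
  ctrl _ (orbit_cocompact (gcw_act C) y0).
(* With this level [s] the ball at [tau 0] already contains [h y0]. *)
set s := - _ => -[lam _ [join _]].
have [J finJ cov] := cocompact_finite_cells cL'.
set U := (\bigcup_(i in J) ocell i) in cov.
have [D DP] : exists D, forall y, U y -> mdist (h y) (Vertex 1%g) <= D.
  apply: (ubounded_cells finJ) => y.
  exact: (@continuous_comp _ _ _ h (fun p => mdist p (Vertex 1%g)) y (h_cont y)
    (@mdist_continuous _ _ _ _)).
have [m mP] := horoball_expsum ct htau (s - lam - D).
apply: hB; exists m.
pose F := [set g | exists2 y, closure U y & U (gcw_act C g^-1%g y)].
exists (@sdl _ _ phi @` F); first exact/finite_image/finite_adjacent.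
apply/seteqP; split => // b _; set H := generated _.
have [g0 g0y0] : exists g, U (gcw_act C g^-1%g y0).
  by apply/cov/LL'; exists 1%g; rewrite gact1.
(* [y0] need not lie in [U] itself but in [g0 U], so the [B]-components are
   compared with that of [g0]; conjugating [b] makes up for it at the end. *)
pose k : sdprod phi := SDPair phi (sdl g0 * b * (sdl g0)^-1)%g 1%g.
have hk : h (gcw_act C k y0) = h y0.
  by rewrite h_equiv /= /tree_act_fun /=; case: (h y0) => *; rewrite /= mul1g.
have s0 : horoball tau s (h y0).
  by exists 0; rewrite ?sub0r ?opprK // ge_max lexx oppr_le0 mdist_ge0.
have in_Yray g : h (gcw_act C g y0) = h y0 ->
    (Yray C h tau s `&` [set y | exists g, y = gcw_act C g y0]) (gcw_act C g y0).
  by move=> hg; split; [apply: vertex_Yray i0y0 _; rewrite hg | exists g].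
have [f [f_cont f0 f1 fP]] :
    joined_in R (Yray C h tau (s - lam) `&` L') y0 (gcw_act C k y0).
  apply: join; last exact: in_Yray.
  by have := in_Yray 1%g; rewrite gact1; apply.
set P := f @` _ in fP.
have Py0 : P y0 by rewrite -f0; exists 0 => //=; rewrite in_itv /= lexx ler01.
have Pky0 : P (gcw_act C k y0).
  by rewrite -f1; exists 1 => //=; rewrite in_itv /= lexx ler01.
have cP : compact P by apply: continuous_compact => //; exact: segment_compact.
have connP : connected P.
  by apply: connected_continuous_connected => //; exact: segment_connected.
have meets_expsum g : (exists2 y, P y & U (gcw_act C g^-1%g y)) ->
    expsum a t (sdr g) < m.
  move=> [y /fP[[Z [_ Zh] /Zh[l]]]]; rewrite ge_max => /andP[l0 sl] ly _ Uy.
  have d : mdist (h y) (Vertex (sdr g)) <= D.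
    have -> : h y = tmul (sdr g) (h (gcw_act C g^-1%g y)).
      by rewrite -[LHS](congr1 h (actVK C g y)) h_equiv.
    by have := DP _ Uy; rewrite -(tmul_isom (sdr g)) /= mulg1.
  have D0 : 0 <= D by apply: le_trans (mdist_ge0 _ _) d.
  apply: mP; exists l; first by rewrite ge_max l0; lra.
  by have := metric_triangle (tau l) (h y) (Vertex (sdr g)); lra.
suff : H ((sdl g0)^-1 * sdl (k * g0))%g.
  by rewrite /= aut_id -!mulgA mulVg mulg1 mulKg.
apply: (connected_translates freeC finJ
  (Q := fun g => H ((sdl g0)^-1 * sdl g)%g) cP connP _ _ (g := g0)).
- by move=> y /fP[_ /cov].
- move=> g g' y mg _ Uy Uy'.
  have -> : sdl g' = (sdl g * phi (sdr g) (sdl (g^-1 * g')%g))%g.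
    by rewrite -[in LHS](mulVKg g g').
  rewrite mulgA; apply: iff_sym; apply: generatedMr; apply: generated_sub.
  exists (sdl (g^-1 * g')%g), (sdr g); split => //.
    by exists (g^-1 * g')%g => //; exists y.
  by rewrite /= => /(lt_le_trans (meets_expsum g mg)); rewrite ltxx.
- by exists y0.
- by exists (gcw_act C k y0) => //; rewrite invgM gactM actK.
- by rewrite mulVg; case: (generated_subgroup _ : subgroup_set H).
Qed.
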